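(* Let $n,T\in\mathbb{N}$ with $n\ge1$, $T\ge 2$, and let $z_1,\ldots,z_{n+1}$ be nonnegative reals with $z_1+\cdots+z_{n+1}=1$. Let $M$ be the transition matrix of the doubly enriched chain on $\tilde{\mathcal{T}}_n^T$ described in the context. Then the eigenvalues of $M$ are $1$, with multiplicity $1$, and $0$, with multiplicity $(n+1)^{n(T-1)}-1$.
   Context: $\tilde{\mathcal{T}}_n^T$ is the set of $(T-1)\times n$ matrices with entries in $\{1,\ldots,n+1\}$ (there are $(n+1)^{n(T-1)}$ of them). The transition probability from $A$ to $N$ is $\prod_{i=1}^{T-1}z_{N_{i,1}}$ if $N_{k,l}=A_{k,l-1}$ for all $k\in\{1,\ldots,T-1\}$ and $l\in\{2,\ldots,n\}$, and $0$ otherwise (the last column is deleted, the others shifted right, and a new first column is chosen with independent entries distributed according to $(z_1,\ldots,z_{n+1})$). *)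

(* Defs.v *)
From mathcomp Require Import all_boot all_order all_algebra.
From mathcomp Require Import complex reals.

Set Implicit Arguments.
Unset Strict Implicit.
Unset Printing Implicit Defensive.

Import Order.TTheory GRing.Theory Num.Theory.
Local Open Scope ring_scope.

(* Letters, rows and columns are numbered from 0: the letter i of {1,...,n+1} *)
(* is the ordinal i - 1 in 'I_n.+1, and the first column is column 0.         *)
Definition dstate (n T : nat) := 'M['I_n.+1]_(T - 1, n).

Definition shifted (n T : nat) (A N : dstate n T) : bool :=
  [forall k : 'I_(T - 1), forall l : 'I_n, forall l' : 'I_n,
     (l == l'.+1 :> nat) ==> (N k l == A k l')].

Definition trans_prob (R : realType) (n T : nat) (hn : (1 <= n)%N)
    (z : 'I_n.+1 -> R) (A N : dstate n T) : R :=
  if shifted A N then \prod_(i < T - 1) z (N i (Ordinal hn)) else 0.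

Definition trans_mx (R : realType) (n T : nat) (hn : (1 <= n)%N)
    (z : 'I_n.+1 -> R) : 'M[R]_(#|{: dstate n T}|) :=
  \matrix_(a, b) trans_prob hn z (enum_val a) (enum_val b).

Definition alg_mult (F : fieldType) (m : nat) (A : 'M[F]_m) (a : F) : nat :=
  mup a (char_poly A).

(* Main.v *)
Require Import Defs.
From mathcomp Require Import all_boot all_order all_algebra.
From mathcomp Require Import complex reals.
Set Implicit Arguments.
Unset Strict Implicit.
Unset Printing Implicit Defensive.

Import Order.TTheory GRing.Theory Num.Theory.
Local Open Scope ring_scope.

(** Let [v] be a right eigenvector for [a <> 0]. The value [(M v) A] does not
    depend on the last column of [A], so neither does that of [v = a^-1 M v];
    repeating this [n] times, [v] is constant, and [a = 1] because [M] is
    stochastic. Hence the spectrum lies in [{0, 1}] and the multiplicity of [1]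
    is the trace of [M]. The diagonal of [M] is supported by the states with
    constant rows, whose weights sum to [(z_1 + ... + z_(n+1))^(T-1) = 1]. *)

(** [eigenvalue] speaks of row vectors acted on from the right; transposing gives access to right
    eigenvectors, which are functions on states. *)
Lemma eigenvalue_tr (F : fieldType) (m : nat) (A : 'M[F]_m) (a : F) :
  eigenvalue A^T a = eigenvalue A a.
Proof.
rewrite /eigenvalue /eigenspace !kermx_eq0 !row_free_unit -unitmx_tr.
by rewrite linearB /= trmxK tr_scalar_mx.
Qed.

Lemma mup_char_poly_eigenvalue01 (F : numClosedFieldType) (m : nat)
    (A : 'M[F]_m) :
  (0 < m)%N -> (forall a, eigenvalue A a -> a = 0 \/ a = 1) -> \tr A = 1 ->
  mup 1 (char_poly A) = 1%N /\ mup 0 (char_poly A) = (m - 1)%N.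
Proof.
move=> m_gt0 eig01 trA.
have [rs] := closed_field_poly_normal (char_poly A).
rewrite (monicP (char_poly_monic A)) scale1r => Ers.
have rs01 : {in rs, forall a, a = 0 \/ a = 1}.
  move=> a a_rs; apply: eig01.
  by rewrite eigenvalue_root_char Ers root_prod_XsubC.
have sz_rs : size rs = m.
  by have := size_char_poly A; rewrite Ers size_prod_XsubC => -[].
have sum_rs : \sum_(a <- rs) a = (count_mem 1 rs)%:R.
  rewrite -sum1_count natr_sum [RHS]big_mkcond /=.
  by apply: eq_big_seq => a /rs01[] ->; rewrite ?eqxx // eq_sym oner_eq0.
have count1 : count_mem 1 rs = 1%N.
  (* The coefficient of degree [m - 1] is both minus the trace and minus the sum of the roots;
     characteristic 0 lets the count be read off in [F]. *)
  apply/eqP; rewrite -(@eqr_nat F) -sum_rs -trA -eqr_opp.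
  by rewrite -char_poly_trace // Ers -sz_rs coefPn_prod_XsubC // sz_rs -lt0n.
rewrite Ers !mu_prod_XsubC count1; split=> //.
rewrite -sz_rs -(count_predC (pred1 1) rs) count1 addKn.
apply: eq_in_count => a /rs01[] -> /=; first by rewrite eqxx eq_sym oner_eq0.
by rewrite eqxx oner_eq0.
Qed.

(** The successors of [A], parametrized by the new first column. The truncated predecessor at
    [l = 0] falls in the branch not taken. *)
Definition push_col (n T : nat) (f : {ffun 'I_(T - 1) -> 'I_n.+1})
    (A : dstate n T) : dstate n T :=
  \matrix_(k, l) if l == 0 :> nat then f k
                 else A k (Ordinal (leq_ltn_trans (leq_pred l) (ltn_ord l))).

Definition first_col (n T : nat) (hn : (1 <= n)%N) (A : dstate n T) :
    {ffun 'I_(T - 1) -> 'I_n.+1} :=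
  [ffun k => A k (Ordinal hn)].

Lemma push_colK (n T : nat) (hn : (1 <= n)%N) f (A : dstate n T) :
  first_col hn (push_col f A) = f.
Proof. by apply/ffunP => k; rewrite ffunE mxE. Qed.

Lemma shiftedE (n T : nat) (hn : (1 <= n)%N) (A N : dstate n T) :
  shifted A N = (push_col (first_col hn N) A == N).
Proof.
apply/idP/eqP => [/forallP sAN | <-].
  apply/matrixP => k l; rewrite mxE; case: eqP => [l0 | /eqP l_neq0].
    by rewrite ffunE; congr (N k _); apply/val_inj.
  set l' := Ordinal _.
  move/forallP: (sAN k) => /(_ l)/forallP/(_ l')/implyP h.
  by symmetry; apply/eqP/h; rewrite /= prednK // lt0n.
apply/forallP=> k; apply/forallP=> l; apply/forallP=> l'.
apply/implyP => /eqP ll'; rewrite mxE ifN ?ll' //; apply/eqP; congr (A k _).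
by apply/val_inj; rewrite /= ll'.
Qed.

Section Chain.
Variables (R : realType) (n T : nat) (hn : (1 <= n)%N) (z : 'I_n.+1 -> R).
Hypothesis z_sum1 : \sum_(i < n.+1) z i = 1.

Let weight (f : {ffun 'I_(T - 1) -> 'I_n.+1}) : R := \prod_i z (f i).

Lemma sum_col_weight : \sum_f weight f = 1.
(* Distributivity turns the sum over columns into a product of [T - 1] sums of [z]. *)
Proof. by rewrite /weight -(bigA_distr_bigA (fun=> z)) big1. Qed.

Lemma trans_probE (A N : dstate n T) :
  trans_prob hn z A N =
  if push_col (first_col hn N) A == N then weight (first_col hn N) else 0.
Proof.
rewrite /trans_prob (shiftedE hn); case: ifP => // _.
by apply: eq_bigr => i _; rewrite ffunE.
Qed.

Lemma sum_trans_prob (G : dstate n T -> R[i]) (A : dstate n T) :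
  \sum_N real_complex R (trans_prob hn z A N) * G N =
  \sum_f real_complex R (weight f) * G (push_col f A).
Proof.
rewrite [RHS](reindex_onto (first_col hn) (fun f => push_col f A)) /=;
  last first.
  by move=> f _; rewrite push_colK.
rewrite [RHS]big_mkcond; apply: eq_bigr => N _; rewrite trans_probE.
by case: eqP => [-> //|_]; rewrite rmorph0 mul0r.
Qed.

Lemma eigenfun_const (G : dstate n T -> R[i]) (a : R[i]) : a != 0 ->
  (forall A, \sum_N real_complex R (trans_prob hn z A N) * G N = a * G A) ->
  forall A B, G A = G B.
Proof.
move=> a_neq0 eigG.
(* Induction on the number [j] of trailing columns that [G] ignores; at [j = n] no condition is
   left. *)
suff agree j (A B : dstate n T) :
    (forall k (l : 'I_n), (l < n - j)%N -> A k l = B k l) -> G A = G B.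
  by move=> A B; apply: (agree n) => k l; rewrite subnn.
elim: j A B => [|j IHj] A B AB.
  by congr G; apply/matrixP => k l; apply: AB; rewrite subn0.
(* Pushing the same column onto [A] and [B] makes them agree on one more leading column, so the
   induction hypothesis applies term by term. *)
apply: (mulfI a_neq0); rewrite -!eigG !sum_trans_prob.
apply: eq_bigr => f _; congr (_ * _); apply: IHj => k l lj; rewrite !mxE.
case: eqP => // /eqP l_neq0; apply: AB => /=.
by rewrite subnS -ltnS !prednK ?(leq_ltn_trans _ lj) // lt0n.
Qed.

Lemma eigenvalue_trans_mx (a : R[i]) :
  eigenvalue (map_mx (real_complex R) (trans_mx T hn z)) a -> a = 0 \/ a = 1.
Proof.
set M := map_mx _ _; rewrite -eigenvalue_tr => /eigenvalueP[v vM v_neq0].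
have [-> | a_neq0] := eqVneq a 0; [by left | right].
pose G A := v 0 (enum_rank A).
have eigG A : \sum_N real_complex R (trans_prob hn z A N) * G N = a * G A.
  have /rowP/(_ (enum_rank A)) := vM; rewrite !mxE => <-.
  rewrite [RHS](reindex enum_rank) /=; last exact/onW_bij/enum_rank_bij.
  by apply: eq_bigr => N _; rewrite !mxE !enum_rankK mulrC.
have constG := eigenfun_const a_neq0 eigG.
have [i vi_neq0] : exists i, v 0 i != 0 by apply/rV0Pn.
have Gi : G (enum_val i) != 0 by rewrite /G enum_valK.
(* At a state where [G] is nonzero, the eigenvalue equation averages a constant with weights of sum
   1. *)
apply: (mulIf Gi); rewrite -eigG sum_trans_prob.
under eq_bigr => f _ do rewrite (constG _ (enum_val i)).
by rewrite -mulr_suml -rmorph_sum sum_col_weight rmorph1.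
Qed.

Definition const_rows (f : {ffun 'I_(T - 1) -> 'I_n.+1}) : dstate n T :=
  \matrix_(k, l) f k.

Lemma first_col_const_rows f : first_col hn (const_rows f) = f.
Proof. by apply/ffunP => k; rewrite ffunE mxE. Qed.

(** A state that may follow itself has each column equal to the preceding one, hence to the first,
    by induction on the column index. *)
Lemma push_col_fixed (A : dstate n T) :
  (push_col (first_col hn A) A == A) = (const_rows (first_col hn A) == A).
Proof.
apply/eqP/eqP => /matrixP fixA; apply/matrixP => k l; last first.
  by rewrite mxE -(fixA k (Ordinal _)) -(fixA k l) !mxE if_same.
rewrite mxE; case: l; elim=> [|l IHl] hl.
  by rewrite ffunE; congr (A k _); apply/val_inj.
rewrite -fixA mxE /= (IHl (ltnW hl)).
by congr (A k _); apply/val_inj.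
Qed.

Lemma trace_trans_mx : \tr (trans_mx T hn z) = 1.
Proof.
rewrite -sum_col_weight /mxtrace.
rewrite (reindex enum_rank) /=; last exact/onW_bij/enum_rank_bij.
rewrite [RHS](reindex_onto (first_col hn) const_rows) /=; last first.
  by move=> f _; rewrite first_col_const_rows.
rewrite [RHS]big_mkcond; apply: eq_bigr => A _.
by rewrite mxE enum_rankK trans_probE push_col_fixed.
Qed.

End Chain.

Theorem theorem3p13 (R : realType) (n T : nat) (hn : (1 <= n)%N)
    (hT : (2 <= T)%N) (z : 'I_n.+1 -> R)
    (z_ge0 : forall i, 0 <= z i) (z_sum1 : \sum_(i < n.+1) z i = 1) :
  let M := map_mx (real_complex R) (trans_mx T hn z) in
  [/\ forall a : complex R, eigenvalue M a <-> a = 1 \/ a = 0,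
      alg_mult M 1 = 1%N
    & alg_mult M 0 = ((n.+1 ^ (n * (T - 1))) - 1)%N].
Proof.
move=> M; rewrite /alg_mult.
have card_state : #|{: dstate n T}| = (n.+1 ^ (n * (T - 1)))%N.
  by rewrite card_mx card_ord mulnC.
(* At least two states, by [hn] and [hT]: this makes the multiplicity of 0 positive, so that 0
   really is an eigenvalue. *)
have card_gt1 : (1 < #|{: dstate n T}|)%N.
  rewrite card_state -[ltnLHS](exp1n (n * (T - 1))) ltn_exp2r ?ltnS //.
  by rewrite muln_gt0 hn subn_gt0.
have eig01 : forall a, eigenvalue M a -> a = 0 \/ a = 1.
  exact: eigenvalue_trans_mx.
have trM : \tr M = 1 by rewrite trace_map_mx trace_trans_mx ?rmorph1.
have [mu1 mu0] :
    mup 1 (char_poly M) = 1%N /\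
    mup 0 (char_poly M) = (#|{: dstate n T}| - 1)%N.
  exact: mup_char_poly_eigenvalue01 (ltnW card_gt1) eig01 trM.
have root_mup a : (0 < mup a (char_poly M))%N -> eigenvalue M a.
  by rewrite eigenvalue_root_char; apply: contraLR => /mupNroot ->.
rewrite -card_state; split=> // a; split; first by case/eig01; [right | left].
by case=> ->; apply: root_mup; rewrite ?mu1 // mu0 subn_gt0.
Qed.
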